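(* Let $X$ be a ball quasi-Banach function space on $\mathbb R^n$ and $\theta\in(0,1)$. Assume that there exists $r\in(0,\infty)$ such that $X^{1/r}$ is a ball Banach function space. Then $$(X,L^\infty(\mathbb R^n))_{\theta,\infty}=(WX)^{1/(1-\theta)}$$ with equivalent quasi-norms.
   Context: A ball quasi-Banach function space is a quasi-Banach space $X$ of measurable functions on $\mathbb R^n$ such that: $\|f\|_X=0$ implies $f=0$ a.e.; $|g|\le|f|$ a.e. implies $\|g\|_X\le\|f\|_X$; $0\le f_m\uparrow f$ a.e. implies $\|f_m\|_X\uparrow\|f\|_X$; and $\mathbf 1_B\in X$ for every ball $B$. It is a ball Banach function space if moreover $\|\cdot\|_X$ satisfies the triangle inequality and for every ball $B$ there is $C_B$ with $\int_B|f|\le C_B\|f\|_X$. For $p\in(0,\infty)$, $Y^p:=\{f:|f|^p\in Y\}$ with $\|f\|_{Y^p}:=\||f|^p\|_Y^{1/p}$. $WX$ is the set of measurable $f$ with $\|f\|_{WX}:=\sup_{\alpha>0}\alpha\|\mathbf 1_{\{x:|f(x)|>\alpha\}}\|_X<\infty$. Real interpolation: $K(t,f;X_0,X_1):=\inf\{\|f_0\|_{X_0}+t\|f_1\|_{X_1}:f=f_0+f_1,\ f_i\in X_i\}$, and $(X_0,X_1)_{\theta,\infty}$ is the set of $f\in X_0+X_1$ with $\|f\|_{\theta,\infty}:=\sup_{t>0}t^{-\theta}K(t,f;X_0,X_1)<\infty$. *)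

(* Defs.v *)
From HB Require Import structures.
From mathcomp Require Import all_boot all_order all_algebra.
From mathcomp Require Import all_classical all_reals all_analysis.
From mathcomp Require Import ess_sup_inf.
Set Implicit Arguments. Unset Strict Implicit. Unset Printing Implicit Defensive.
Import Order.TTheory GRing.Theory Num.Def Num.Theory.
Import numFieldNormedType.Exports.
Local Open Scope classical_set_scope.
Local Open Scope ring_scope.

(* Lebesgue measure on R^n, built as the Caratheodory measure of the  *)
(* Lebesgue outer measure                                             *)
(*   lambda^*(A) = inf { sum_k vol(Q_k) : A ⊆ ⋃_k Q_k, Q_k boxes }    *)
(* with half-open boxes Q = prod_i [a_i, b_i).                        *)

Definition Rn (R : realType) (n : nat) := 'rV[R]_n.

(* auxiliary copy of R^n on which all subsets are declared "measurable";
   it only serves to reuse the library's covering outer measure [mu_ext]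
   (covers by arbitrary sets, whose cost is +oo unless they are boxes) *)
Definition RnCover (R : realType) (n : nat) := Rn R n.
Definition rncover_display : measure_display. Proof. exact. Qed.

Section lebesgue_Rn.
Context (R : realType) (n : nat).

HB.instance Definition _ := Pointed.on (Rn R n).
HB.instance Definition _ := Pointed.on (RnCover R n).

Let cover_set0 : @setT (set (RnCover R n)) set0. Proof. by []. Qed.
Let cover_setC (A : set (RnCover R n)) : setT A -> setT (~` A). Proof. by []. Qed.
Let cover_bigcup (F : (set (RnCover R n))^nat) :
  (forall i, setT (F i)) -> setT (\bigcup_i F i).
Proof. by []. Qed.

HB.instance Definition _ := @isMeasurable.Build rncover_display (RnCover R n)
  setT cover_set0 cover_setC cover_bigcup.

Definition box (a b : Rn R n) : set (RnCover R n) :=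
  [set x | forall i : 'I_n, a ord0 i <= x ord0 i < b ord0 i].

Definition box_vol (a b : Rn R n) : \bar R :=
  (\prod_(i < n) Num.max (b ord0 i - a ord0 i) 0)%:E.

(* volume of a box (0 for the empty set); +oo for sets that are not boxes *)
Definition box_content (A : set (RnCover R n)) : \bar R :=
  ereal_inf [set v | (A = set0 /\ v = 0%E) \/
                     exists a b, A = box a b /\ v = box_vol a b].

Lemma box_vol_ge0 a b : (0 <= box_vol a b)%E.
Proof.
rewrite lee_fin; apply: prodr_ge0 => i _; by rewrite le_max lexx orbT.
Qed.

Lemma box_content_ge0 A : (0 <= box_content A)%E.
Proof.
apply: le_ereal_inf_tmp => v [[_ ->]|[a [b [_ ->]]]] //; exact: box_vol_ge0.
Qed.

Lemma box_content0 : box_content set0 = 0%E.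
Proof.
apply/eqP; rewrite eq_le box_content_ge0 andbT.
by apply: ereal_inf_lbound; left.
Qed.

Definition lebesgue_outer : set (RnCover R n) -> \bar R := mu_ext box_content.

HB.instance Definition _ := isOuterMeasure.Build R (RnCover R n) lebesgue_outer
  (mu_ext0 box_content0 box_content_ge0)
  (mu_ext_ge0 box_content_ge0)
  (le_mu_ext box_content)
  (mu_ext_sigma_subadditive box_content_ge0).

End lebesgue_Rn.

Definition LebRn (R : realType) (n : nat) :=
  caratheodory_type (@lebesgue_outer R n : {outer_measure set (RnCover R n) -> \bar R}).

Definition lebesgue_n (R : realType) (n : nat) : {measure set (LebRn R n) -> \bar R} :=
  (@lebesgue_outer R n : {outer_measure set (RnCover R n) -> \bar R})
     : set (LebRn R n) -> \bar R.

(* A (quasi-)normed space X of measurable functions is represented by *)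
(* its (quasi-)norm extended to all measurable functions,             *)
(*   N : (R^n -> R) -> \bar R,  with  X = {f measurable | N f < +oo}. *)

Section function_spaces.
Context (R : realType) (n : nat).
Local Notation T := (LebRn R n).
Local Notation mu := (lebesgue_n R n).
Local Open Scope ereal_scope.

Definition eball (c : Rn R n) (r : R) : set T :=
  [set x | (\sum_(i < n) ((x : 'rV[R]_n) ord0 i - c ord0 i) ^+ 2 < r ^+ 2)%R].

Definition is_ball (B : set T) : Prop :=
  exists (c : Rn R n) (r : R), (0 < r)%R /\ B = eball c r.

Definition lmeasurable (f : T -> R) : Prop := measurable_fun setT f.

Definition inX (N : (T -> R) -> \bar R) (f : T -> R) : Prop :=
  lmeasurable f /\ N f < +oo.

Record ball_qBfs (N : (T -> R) -> \bar R) : Prop := {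
  bq_ge0 : forall f, lmeasurable f -> 0 <= N f;
  bq_homog : forall (c : R) f, lmeasurable f -> N (fun x => c * f x)%R = `|c|%:E * N f;
  bq_quasi_triangle : exists K : R, (1 <= K)%R /\
    forall f g, lmeasurable f -> lmeasurable g -> N (f \+ g)%R <= K%:E * (N f + N g);
  bq_complete : forall u : nat -> T -> R, (forall k, inX N (u k)) ->
    (forall e : R, (0 < e)%R -> exists k0, forall k l, (k0 <= k)%N -> (k0 <= l)%N ->
       N (u k \- u l)%R < e%:E) ->
    exists f, inX N f /\ (fun k => N (u k \- f)%R) @ \oo --> 0;
  bq_definite : forall f, lmeasurable f -> N f = 0 -> {ae mu, forall x, f x = 0%R};
  bq_lattice : forall f g, lmeasurable f -> lmeasurable g ->
    {ae mu, forall x, (`|g x| <= `|f x|)%R} -> N g <= N f;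
  bq_fatou : forall (fs : nat -> T -> R) (f : T -> R),
    (forall m, lmeasurable (fs m)) -> lmeasurable f ->
    {ae mu, forall x, (forall m, (0 <= fs m x <= fs m.+1 x)%R) /\
                      (fun m => fs m x) @ \oo --> f x} ->
    (forall m, N (fs m) <= N (fs m.+1)) /\ (fun m => N (fs m)) @ \oo --> N f;
  bq_balls : forall B, is_ball B -> N (\1_B : T -> R) < +oo
}.

Record ball_Bfs (N : (T -> R) -> \bar R) : Prop := {
  bB_qBfs : ball_qBfs N;
  bB_triangle : forall f g, lmeasurable f -> lmeasurable g -> N (f \+ g)%R <= N f + N g;
  bB_local : forall B, is_ball B -> exists C : R,
    forall f, inX N f -> \int[mu]_(x in B) (`|f x|)%:E <= C%:E * N f
}.

Definition convexify (N : (T -> R) -> \bar R) (p : R) : (T -> R) -> \bar R :=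
  fun f => (N (fun x => `|f x| `^ p)%R) `^ p^-1.

Definition weak (N : (T -> R) -> \bar R) : (T -> R) -> \bar R :=
  fun f => ereal_sup [set a%:E * N (\1_[set x | (a < `|f x|)%R] : T -> R)
                     | a in [set a : R | (0 < a)%R]].

Definition Linf_norm (f : T -> R) : \bar R := ess_sup mu (fun x => (`|f x|)%:E).

Definition Kfun (N0 N1 : (T -> R) -> \bar R) (t : R) (f : T -> R) : \bar R :=
  ereal_inf [set v | exists f0 f1, [/\ inX N0 f0, inX N1 f1, f = (f0 \+ f1)%R &
                                         v = N0 f0 + t%:E * N1 f1]].

Definition in_sum (N0 N1 : (T -> R) -> \bar R) (f : T -> R) : Prop :=
  exists f0 f1, [/\ inX N0 f0, inX N1 f1 & f = (f0 \+ f1)%R].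

Definition interp_norm (N0 N1 : (T -> R) -> \bar R) (theta : R) (f : T -> R) : \bar R :=
  ereal_sup [set (t `^ (- theta))%:E * Kfun N0 N1 t f | t in [set t : R | (0 < t)%R]].

Definition in_interp (N0 N1 : (T -> R) -> \bar R) (theta : R) (f : T -> R) : Prop :=
  [/\ lmeasurable f, in_sum N0 N1 f & interp_norm N0 N1 theta f < +oo].

End function_spaces.

(* Main.v *)
(** With [p = 1/(1-theta)], the quasi-norm of (WX)^p is at most [c] iff
    N(1_{|f|>a}) <= (c/a)^p for every a > 0.

    Given a decomposition f = f0 + f1 that is nearly optimal for K(t, f) with
    t = (2j/a)^p, j slightly larger than the interpolation norm, |f1| <= a/2
    almost everywhere, so 1_{|f|>a} <= (2/a)|f0| and N(1_{|f|>a}) <= t.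
    Conversely f is split at height [a] into its part on {|f|>a} and the rest;
    the former is bounded by cutting {|f|>a} into the annuli
    {b^k a < |f| <= b^(k+1) a}, with [b] so large that the decay of the
    distribution beats the constant of the quasi-triangle inequality, and by
    the Fatou property.

    The L^oo quasi-norm is nonnegative only because Lebesgue measure on R^n
    does not vanish (an essential supremum for the zero measure is -oo); this
    is proved by integrating a box cover of the unit cube one coordinate at a
    time. *)

Require Import Defs.
From HB Require Import structures.
From mathcomp Require Import all_boot all_order all_algebra.
From mathcomp Require Import all_classical all_reals all_analysis.
From mathcomp Require Import measurable_realfun ess_sup_inf lra ring.
Import Order.TTheory GRing.Theory Num.Def Num.Theory.
Import numFieldNormedType.Exports.
Local Open Scope classical_set_scope.
Local Open Scope ring_scope.

(** * Lebesgue measure on R^n is nonzero *)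

Lemma integral_itv_indic_le (R : realType) (D : set R) (a b c : R) :
  measurable D -> 0 <= c ->
  (\int[lebesgue_measure]_(x in D) (c * (a <= x < b)%R%:R)%:E
    <= (c * Num.max (b - a) 0)%:E)%E.
Proof.
move=> mD c0.
have -> : (fun x : R => (c * (a <= x < b)%R%:R)%:E) =
    (fun x : R => c%:E * (\1_(`[a, b[%classic : set R) x)%:E)%E.
  apply/funext => x; rewrite -EFinM indicE; congr (_ * _)%:E.
  by rewrite mem_setE in_itv.
rewrite ge0_integralZl_EFin//; last by apply/measurable_EFinP; exact: measurable_indic.
rewrite integral_indic// EFinM lee_wpmul2l ?lee_fin//.
apply: (@le_trans _ _ (lebesgue_measure (`[a, b[%classic : set R))).
  by apply: le_measure; rewrite ?inE//; exact: measurableI.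
rewrite lebesgue_measure_itv/= lte_fin; case: ifPn => ab.
  by rewrite -EFinD lee_fin le_max lexx.
by rewrite lee_fin le_max lexx orbT.
Qed.

(* Weights make the induction on [n] go through: slicing along the first
   coordinate turns a weighted cover of the cube into one of dimension [n]. *)
Lemma weighted_cover_vol_ge1 (R : realType) (n : nat) (w : nat -> R)
    (a b : nat -> 'I_n -> R) :
  (forall k, 0 <= w k) ->
  (forall x : 'I_n -> R, (forall i, 0 <= x i < 1) ->
    (1 <= \sum_(k <oo) (w k * \prod_(i < n) (a k i <= x i < b k i)%R%:R)%:E)%E) ->
  (1 <= \sum_(k <oo) (w k * \prod_(i < n) Num.max (b k i - a k i) 0)%:E)%E.
Proof.
elim: n w a b => [|n IH] w a b w0 cov.
  (* In dimension 0 all products are empty, so the covering hypothesis at the only point is the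
     claim. *)
  have := cov (fun=> 0) (fun i => False_ind _ (elimF idP (ltn0 i) (ltn_ord i))).
  rewrite (@eq_eseriesr _ _ (fun k => (w k * \prod_(i < 0) Num.max (b k i - a k i) 0)%:E)) //.
  by move=> k _; rewrite !big_ord0.
pose V k : R := \prod_(i < n) Num.max (b k (lift ord0 i) - a k (lift ord0 i)) 0.
have V0 k : 0 <= V k by apply: prodr_ge0 => i _; rewrite le_max lexx orbT.
pose D : set R := `[0, 1[%classic.
have mD : measurable D by exact: measurable_itv.
have wI0 k x : 0 <= w k * V k * (a k ord0 <= x < b k ord0)%R%:R.
  by rewrite !mulr_ge0.
have slice x : D x ->
    (1 <= \sum_(k <oo) (w k * V k * (a k ord0 <= x < b k ord0)%R%:R)%:E)%E.
  rewrite /D/= in_itv/= => x01.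
  have := IH (fun k => w k * (a k ord0 <= x < b k ord0)%R%:R)
    (fun k i => a k (lift ord0 i)) (fun k i => b k (lift ord0 i)).
  move=> /(_ _ _)/le_trans; apply => [k|y y01|]; first by rewrite mulr_ge0.
    (* The point of the larger cube has coordinate [x] at [ord0] and the coordinates of [y]
       elsewhere. *)
    apply: le_trans (cov (fun i => oapp y x (unlift ord0 i)) _) _ => [i|].
      by case: unliftP => [j|] _ //=.
    apply: lee_nneseries => [k _ _|k _]; first by rewrite lee_fin mulr_ge0// prodr_ge0.
    rewrite big_ord_recl unlift_none/= mulrA.
    by under eq_bigr do rewrite liftK.
  apply: lee_nneseries => [k _ _|k _].
    by rewrite lee_fin; apply: mulr_ge0; [exact: mulr_ge0|exact: V0].
  by rewrite lee_fin mulrAC.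
have mI k : measurable_fun D
    (fun x : R => (w k * V k * (a k ord0 <= x < b k ord0)%R%:R)%:E).
  apply/measurable_EFinP/measurable_funM => //.
  rewrite (_ : (fun x => _) = \1_(`[a k ord0, b k ord0[%classic : set R)).
    exact: measurable_indic.
  by apply/funext => x; rewrite indicE mem_setE in_itv.
(* Integrating [slice] over [0,1) and exchanging sum and integral turns each indicator into at most
   a side length. *)
have -> : 1%E = (\int[lebesgue_measure]_(x in D) (1%:E : \bar R))%E.
  by rewrite integral_cst// mul1e /D/= lebesgue_measure_itv/= lte_fin ltr01 sube0.
apply: (@le_trans _ _ (\int[lebesgue_measure]_(x in D)
   \sum_(k <oo) (w k * V k * (a k ord0 <= x < b k ord0)%R%:R)%:E)%E).
  apply: ge0_le_integral => //.
  apply: ge0_emeasurable_sum => [k x _ _|k _]; last exact: mI.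
  by rewrite lee_fin.
rewrite integral_nneseries//; last by move=> k x _; rewrite lee_fin.
apply: lee_nneseries => [k _ _|k _].
  by apply: integral_ge0 => x _; rewrite lee_fin.
by rewrite big_ord_recl [_ * \prod_(i < n) _]mulrC mulrA integral_itv_indic_le ?mulr_ge0.
Qed.

(** A cover of the space also covers the unit cube, so its boxes have total volume at least 1.
    Replacing contents by volumes of nearly optimal boxes costs at most [e k] each, 1/2 in all,
    which leaves 1/2. *)
Lemma lebesgue_n_setT_gt0 (R : realType) (n : nat) :
  (0 < lebesgue_n R n setT)%E.
Proof.
apply: (@lt_le_trans _ _ (2^-1)%:E); first by rewrite lte_fin invr_gt0.
apply: le_ereal_inf_tmp => _ [A [_ covA] <-].
have [[i Aioo]|] := pselect (exists i, box_content (A i) = +oo%E).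
  rewrite (eseries_pinfty _ _ Aioo) ?leey// => k _.
  by rewrite -ltNye (lt_le_trans _ (box_content_ge0 _)).
rewrite -forallNE => Afin.
pose e (k : nat) : R := 2^-1 / (2 ^ k.+1)%:R.
have e0 k : 0 < e k by rewrite divr_gt0 ?invr_gt0 ?ltr0n ?expn_gt0.
(* [q] holds a weight and two corners. Weight 0 encodes the empty set: for [n = 0] no box is empty
   and each has volume 1. *)
pose P (k : nat) (q : R * ('I_n -> R) * ('I_n -> R)) := [/\ 0 <= q.1.1,
  (forall x : RnCover R n, A k x ->
     q.1.1 = 1 /\ forall i, q.1.2 i <= x ord0 i < q.2 i) &
  ((q.1.1 * \prod_(i < n) Num.max (q.2 i - q.1.2 i) 0)%:E
    <= box_content (A k) + (e k)%:E)%E].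
have [q Pq] : {q & forall k, P k (q k)}.
  apply: (@choice _ _ P) => k.
  have : box_content (A k) \is a fin_num.
    by rewrite ge0_fin_numE ?box_content_ge0// ltey; apply/eqP/Afin.
  move=> /(lb_ereal_inf_adherent (e0 k))[v + vlt].
  move=> [[Ak0 v0]|[a [b [Akab vab]]]].
    exists (0, fun=> 0, fun=> 0); split => //= [x|]; first by rewrite Ak0.
    by rewrite mul0r; move: vlt; rewrite v0 => /ltW.
  exists (1, a ord0, b ord0); split => //= [x|].
    by rewrite Akab => xab; split.
  by rewrite mul1r; move: vlt; rewrite vab => /ltW.
have : (1 <= \sum_(k <oo) ((q k).1.1 * \prod_(i < n) Num.max ((q k).2 i - (q k).1.2 i) 0)%:E)%E.
  apply: weighted_cover_vol_ge1 => [k|x _]; first by case: (Pq k).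
  have [j _ Ajx] := covA (\row_i x i) I.
  have [_ /(_ _ Ajx)[q1 qx] _] := Pq j.
  rewrite (@nneseriesD1 _ _ j)//; last first.
    by move=> k _; rewrite lee_fin mulr_ge0 ?prodr_ge0//; case: (Pq k).
  rewrite q1 mul1r big1 ?leeDl//.
    by apply: nneseries_ge0 => k _ _; rewrite lee_fin mulr_ge0 ?prodr_ge0//; case: (Pq k).
  by move=> i _; have := qx i; rewrite mxE => ->.
move=> /le_trans h.
have : (1 <= \sum_(k <oo) box_content (A k) + (2^-1)%:E)%E.
  apply: h; apply: le_trans; last by apply: epsilon_trick => // k; exact: box_content_ge0.
  apply: lee_nneseries => [k _ _|k _]; last by case: (Pq k).
  rewrite lee_fin mulr_ge0 ?prodr_ge0//; first by case: (Pq k).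
  by move=> i _; rewrite le_max lexx orbT.
rewrite -leeBlDr// -EFinB; congr (_%:E <= _)%E.
by rewrite [X in X - _](splitr 1) mul1r addrK.
Qed.

(** * Positivity and the distributional form of the weak quasi-norm *)

Section real_interpolation.
Context (R : realType) (n : nat).
Local Notation T := (LebRn R n).
Local Notation Linf := (@Linf_norm R n).
Local Notation ind f a := (\1_[set x | (a < `|f x|)%R] : T -> R).

(** Reduces a bound by a quasi-norm [y] to real [c > y]; such [c] is positive even when [y = 0], so
    one may divide by it. *)
Lemma lee_pmul_gt (C : R) (x y : \bar R) : 0 < C -> (0 <= y)%E ->
  (forall c : R, (y < c%:E)%E -> (x <= (C * c)%:E)%E) -> (x <= C%:E * y)%E.
Proof.
move=> C0; case: y => [y|_ _|//]; last by rewrite gt0_muley ?leey// lte_fin.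
rewrite lee_fin => y0 H; rewrite -EFinM; apply/lee_addgt0Pr => e e0.
have := H (y + e / C); rewrite lte_fin ltrDl divr_gt0// => /(_ isT).
by rewrite mulrDr mulrCA divff ?gt_eqF// mulr1 EFinD.
Qed.

Lemma indic_superlevelE (f : T -> R) (a : R) (x : T) :
  ind f a x = (a < `|f x|)%R%:R.
Proof. by rewrite indicE; congr (nat_of_bool _)%:R; apply/idP/idP; rewrite inE. Qed.

Lemma lmeasurable_superlevel (f : T -> R) (a : R) :
  lmeasurable f -> measurable [set x | a < `|f x|].
Proof.
move=> mf.
rewrite -[X in measurable X]setTI.
have mnf : measurable_fun setT (fun x : T => `|f x|).
  by apply: measurableT_comp mf; exact: normr_measurable.
have := mnf measurableT `]a, +oo[%classic (measurable_itv _).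
by congr (measurable (_ `&` _)); apply/seteqP; split => x /=; rewrite in_itv/= andbT.
Qed.

Lemma lmeasurable_indic_superlevel (f : T -> R) (a : R) :
  lmeasurable f -> lmeasurable (ind f a).
Proof. by move=> mf; apply: measurable_indic; exact: lmeasurable_superlevel. Qed.

Lemma Linf_norm_ge0 (f : T -> R) : (0 <= Linf_norm f)%E.
Proof.
apply: ess_sup_gee; first exact: lebesgue_n_setT_gt0.
by apply: nearW => x; rewrite lee_fin.
Qed.

Context (N : (T -> R) -> \bar R) (hN : ball_qBfs N).

Lemma Kfun_ge0 (t : R) (f : T -> R) : 0 <= t -> (0 <= Kfun N Linf t f)%E.
Proof.
move=> t0; apply: le_ereal_inf_tmp => _ [f0 [f1 [[mf0 _] _ _ ->]]].
by rewrite adde_ge0 ?(bq_ge0 hN)// mule_ge0 ?Linf_norm_ge0// lee_fin.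
Qed.

Lemma interp_norm_ge0 (theta : R) (f : T -> R) :
  (0 <= interp_norm N Linf theta f)%E.
Proof.
apply: (@le_trans _ _ ((1 `^ (- theta))%:E * Kfun N Linf 1 f)%E).
  by rewrite mule_ge0 ?Kfun_ge0// lee_fin powR_ge0.
by apply: ereal_sup_ubound; exists 1 => //=.
Qed.

(** Finiteness at [t = 1] forces the infimum to run over a nonempty set of decompositions. *)
Lemma interp_norm_in_sum (theta : R) (f : T -> R) :
  (interp_norm N Linf theta f < +oo)%E -> in_sum N Linf f.
Proof.
move=> Ifin.
have : (Kfun N Linf 1 f < +oo)%E.
  apply: le_lt_trans Ifin; apply: ereal_sup_ubound; exists 1 => //=.
  by rewrite powR1 mul1e.
by move=> /ereal_inf_lt[_ [f0 [f1 [? ? ? _]]] _]; exists f0, f1.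
Qed.

(** Substitute [a ^ p] for the level: |f|^p exceeds [a ^ p] exactly where |f| exceeds [a]. *)
Lemma convexify_weak_leP (p c : R) (f : T -> R) : 0 < p -> 0 < c -> lmeasurable f ->
  (convexify (weak N) p f <= c%:E)%E <->
  (forall a : R, 0 < a ->
    (N (ind f a) <= ((c / a) `^ p)%:E)%E).
Proof.
move=> p0 c0 mf; have pn0 : p != 0 by rewrite gt_eqF.
set g : T -> R := fun x => `|f x| `^ p.
have mg : lmeasurable g.
  rewrite /lmeasurable /g.
  apply: (@measurableT_comp _ _ _ _ _ _ (@powR R ^~ p) _ (fun x => `|f x|)).
    exact: measurable_powR.
  by apply: measurableT_comp mf; exact: normr_measurable.
have W0 : (0 <= weak N g)%E.
  apply: (@le_trans _ _ (1%:E * N (ind g 1))%E).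
    by rewrite mul1e (bq_ge0 hN)//; exact: lmeasurable_indic_superlevel.
  by apply: ereal_sup_ubound; exists 1 => //=.
have powle (q : R) (x y : \bar R) : 0 <= q -> (0 <= x)%E -> (x <= y)%E ->
    (x `^ q <= y `^ q)%E.
  move=> q0 x0 xy; apply: gt0_ler_poweR => //; rewrite in_itv/= ?leey ?andbT//.
  exact: le_trans xy.
have -> : (convexify (weak N) p f <= c%:E)%E <-> (weak N g <= (c `^ p)%:E)%E.
  rewrite /convexify -/g; split => [|] /powle; [move=> /(_ p)|move=> /(_ p^-1)].
    rewrite -poweRrM mulVf// poweRe1// poweR_EFin; apply; first exact: ltW.
    exact: poweR_ge0.
  rewrite poweR_EFin -powRrM mulfV// powRr1 ?(ltW c0)//; apply => //.
  by rewrite invr_ge0 ltW.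
have lev a : 0 < a -> [set x | a `^ p < `|g x|] = [set x | a < `|f x|].
  move=> a0; apply/seteqP; split => x /=; rewrite /g (@ger0_norm _ (_ `^ _)) ?powR_ge0//.
    by apply: contraTT; rewrite -!leNgt => fa; apply: ge0_ler_powR => //; rewrite ?nnegrE// ltW.
  by move=> af; apply: gt0_ltr_powR => //; rewrite ?nnegrE// ltW.
have eqv a : 0 < a -> ((a `^ p)%:E * N (ind g (a `^ p)%R)
    <= (c `^ p)%:E)%E = (N (ind f a) <= ((c / a) `^ p)%:E)%E.
  move=> a0; rewrite lev// -lee_pdivlMl ?powR_gt0// -EFinM.
  congr (_ <= _%:E)%E; rewrite powRM ?invr_ge0 ?ltW// mulrC; congr (_ * _).
  by rewrite -[a^-1]powR_inv1 ?ltW// -powRrM mulN1r powRN.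
split=> [/ereal_supP H a a0|H].
  by rewrite -eqv//; apply: H; exists (a `^ p) => //=; exact: powR_gt0.
apply/ereal_supP => _ [a /= a0 <-].
have ap : 0 < a `^ p^-1 by exact: powR_gt0.
by have := eqv _ ap; rewrite -powRrM mulVf// (powRr1 (ltW a0)) => ->; exact: H.
Qed.

(** * The weak quasi-norm is controlled by the interpolation norm *)

Lemma superlevel_le_interp (theta j a : R) (f : T -> R) :
  0 < theta < 1 -> lmeasurable f -> 0 < j -> 0 < a ->
  (interp_norm N Linf theta f < j%:E)%E ->
  (N (ind f a) <= ((2 * j / a) `^ (1 - theta)^-1)%:E)%E.
Proof.
move=> /andP[th0 th1] mf j0 a0 If.
have th1' : 1 - theta != 0 by rewrite subr_eq0 gt_eqF.
set s := 2 * j / a.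
have s0 : 0 < s by rewrite divr_gt0// mulr_gt0.
set t := s `^ (1 - theta)^-1.
have t0 : 0 < t by exact: powR_gt0.
(* Equivalently t^(1-theta) = s = 2j/a. Hence j t^theta / t = a/2, which bounds [f1], and (2/a) j
   t^theta = t, which bounds the multiple of [f0]. *)
have ts : t `^ theta * s = t.
  rewrite -[s in _ * s](powRr1 (ltW s0)) -(mulVf th1') powRrM -/t.
  by rewrite -powRD ?(gt_eqF t0) ?implybT// addrC subrK powRr1 // ltW.
have : (Kfun N Linf t f < (j * t `^ theta)%:E)%E.
  have : ((t `^ (- theta))%:E * Kfun N Linf t f < j%:E)%E.
    by apply: le_lt_trans If; apply: ereal_sup_ubound; exists t.
  by rewrite powRN lte_pdivrMl ?powR_gt0// -EFinM mulrC.
move=> /ereal_inf_lt[_ [f0 [f1 [[mf0 _] [mf1 _] ff -> H]]]].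
have Nf0 : (N f0 <= (j * t `^ theta)%:E)%E.
  apply: le_trans (ltW H); rewrite leeDl// mule_ge0 ?Linf_norm_ge0// lee_fin ltW//.
have : (Linf_norm f1 <= (a / 2)%:E)%E.
  have : (t%:E * Linf_norm f1 <= (j * t `^ theta)%:E)%E.
    by apply: le_trans (ltW H); rewrite leeDr// (bq_ge0 hN).
  rewrite -lee_pdivlMl// => /le_trans; apply.
  rewrite -EFinM lee_fin -{1}ts invfM /s.
  have tt0 := powR_gt0 theta t0.
  by rewrite le_eqVlt; apply/orP; left; apply/eqP; field; rewrite !gt_eqF.
move=> /ess_supP f1a.
apply: (@le_trans _ _ (N (fun x => 2 / a * f0 x))); last first.
  rewrite (bq_homog hN)// ger0_norm ?divr_ge0 ?(ltW a0)//.
  apply: (@le_trans _ _ ((2 / a)%:E * (j * t `^ theta)%:E)%E).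
    by rewrite lee_wpmul2l// lee_fin divr_ge0// ltW.
  by rewrite -EFinM lee_fin -{2}ts /s le_eqVlt; apply/orP; left; apply/eqP; ring.
apply: (bq_lattice hN).
- by apply: measurable_funM => //; exact: measurable_cst.
- exact: lmeasurable_indic_superlevel.
apply: filterS f1a => x; rewrite lee_fin => f1x.
rewrite indicE normrM (@ger0_norm _ (2 / a)) ?divr_ge0 ?(ltW a0)//.
have [|_] := boolP (x \in _); last by rewrite normr0 mulr_ge0 ?divr_ge0 ?(ltW a0).
rewrite inE/= normr1 => afx.
have : a / 2 <= `|f0 x|.
  have : `|f x| <= `|f0 x| + `|f1 x| by rewrite ff/= ler_normD.
  by move: afx f1x; lra.
by rewrite mulrAC ler_pdivlMr// mul1r => ?; lra.
Qed.

Lemma convexify_weak_le_interp (theta : R) (f : T -> R) :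
  0 < theta < 1 -> lmeasurable f ->
  (convexify (weak N) (1 - theta)^-1 f
     <= 2%:E * interp_norm N Linf theta f)%E.
Proof.
move=> th mf; have /andP[th0 th1] := th.
apply: lee_pmul_gt => //; first exact: interp_norm_ge0.
move=> c cI; have c0 : 0 < c.
  by rewrite -lte_fin; apply: le_lt_trans cI; exact: interp_norm_ge0.
apply/convexify_weak_leP => //.
- by rewrite invr_gt0 subr_gt0.
- by rewrite mulr_gt0.
by move=> a a0; exact: superlevel_le_interp.
Qed.

(** * The interpolation norm is controlled by the weak quasi-norm *)

Lemma lmeasurable_annulus (f : T -> R) (a b : R) : lmeasurable f ->
  lmeasurable (fun x => `|f x| * (a < `|f x| <= b)%R%:R).
Proof.
move=> mf; have mnf : lmeasurable (fun x => `|f x|).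
  by apply: measurableT_comp mf; exact: normr_measurable.
(* The maximum makes the two indicators cancel when [b < a] and the annulus is empty. *)
have -> : (fun x => `|f x| * (a < `|f x| <= b)%R%:R) =
    (fun x => `|f x| * (ind f a x - ind f (Num.max a b) x)).
  apply/funext => x; congr (_ * _).
  rewrite !indic_superlevelE.
  rewrite gt_max.
  by case: ltP => //= _; [rewrite ltNge; case: leP => //= _|]; rewrite ?subr0 ?subrr.
apply: measurable_funM => //; apply: measurable_funB;
  exact: lmeasurable_indic_superlevel.
Qed.

(* Peeling off one annulus {a < |f| <= b a} costs a factor [K] in the
   quasi-triangle inequality, while the bound gains [b^(1-p) = 1/(2K)]. *)
Lemma annulus_norm_le (K b p w : R) (f : T -> R) : lmeasurable f ->
  1 <= K -> 1 < b -> 0 < w -> b `^ p = 2 * K * b ->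
  (forall g h, lmeasurable g -> lmeasurable h ->
    (N (g \+ h)%R <= K%:E * (N g + N h))%E) ->
  (forall a : R, 0 < a -> (N (ind f a) <= ((w / a) `^ p)%:E)%E) ->
  forall m (a : R), 0 < a ->
  (N (fun x => `|f x| * (a < `|f x| <= b ^+ m * a)%R%:R)%R
     <= (2 * K * b * (a * (w / a) `^ p))%:E)%E.
Proof.
move=> mf K1 b1 w0 bp Ktri Nf.
have K0 : 0 < K by exact: lt_le_trans K1.
have b0 : 0 < b by exact: lt_trans b1.
elim=> [|m IH] a a0.
  (* The annulus is empty; writing zero as [0 * f x] lets homogeneity give norm 0. *)
  have -> : (fun x => `|f x| * (a < `|f x| <= b ^+ 0 * a)%R%:R) =
      (fun x => 0 * f x).
    by apply/funext => x; rewrite mul0r expr0 mul1r; case: ltP => //= ?;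
      rewrite ?mulr0// leNgt; case: ltP => //; rewrite ?mulr0// => ?; lra.
  by rewrite (bq_homog hN)// normr0 mul0e lee_fin !mulr_ge0 ?powR_ge0 ?ltW.
have ba0 : 0 < b * a by exact: mulr_gt0.
(* [g] dominates |f| on the first annulus; [h] collects the other [m], which start at height
   [b * a]. *)
set g : T -> R := fun x => b * a * ind f a x.
set h : T -> R := fun x => `|f x| * (b * a < `|f x| <= b ^+ m * (b * a))%R%:R.
have mg : lmeasurable g.
  by apply: measurable_funM => //; exact: lmeasurable_indic_superlevel.
have mh : lmeasurable h by exact: lmeasurable_annulus.
apply: (@le_trans _ _ (N (g \+ h)%R)).
  apply: (bq_lattice hN); [exact: measurable_funD|exact: lmeasurable_annulus|].
  apply: nearW => x; rewrite /g /h/= indic_superlevelE.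
  rewrite [leRHS]ger0_norm ?addr_ge0 ?mulr_ge0 ?(ltW a0) ?(ltW b0)//.
  rewrite normrM normr_id normr_nat exprSr mulrA.
  have [af|_] := ltP a; last by rewrite mulr0 addr_ge0 ?mulr_ge0 ?(ltW a0) ?(ltW b0).
  rewrite /= mulr1.
  have [fb|_] := leP `|f x| (b ^+ m * b * a); last first.
    by rewrite mulr0 addr_ge0 ?mulr_ge0 ?(ltW a0) ?(ltW b0).
  have [baf|bfa]/= := ltP (b * a); first by rewrite mulr1; lra.
  by rewrite mulr1 mulr0 addr0.
apply: le_trans (Ktri _ _ mg mh) _.
have Ng : (N g <= (b * a * (w / a) `^ p)%:E)%E.
  rewrite /g (bq_homog hN); last exact: lmeasurable_indic_superlevel.
  by rewrite gtr0_norm// [leRHS]EFinM lee_wpmul2l ?lee_fin ?(ltW ba0)//; exact: Nf.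
have Nh : (N h <= (b * a * (w / a) `^ p)%:E)%E.
  apply: le_trans (IH _ ba0) _; rewrite lee_fin.
  have -> : w / (b * a) = b^-1 * (w / a) by rewrite invfM mulrCA.
  have b'0 : 0 <= b^-1 by rewrite invr_ge0 ltW.
  rewrite (powRM _ b'0); last by rewrite divr_ge0 ?ltW.
  (* This factor cancels the constant of the induction hypothesis, so [h] obeys the same bound as
     [g], and K times twice that bound is the claim. *)
  have -> : b^-1 `^ p = (2 * K * b)^-1.
    by rewrite -bp -(powR_inv1 (ltW b0)) -powRrM mulN1r powRN.
  rewrite le_eqVlt; apply/orP; left; apply/eqP; field.
  by rewrite !gt_eqF.
apply: (@le_trans _ _ (K%:E * ((b * a * (w / a) `^ p)%:E + (b * a * (w / a) `^ p)%:E))%E).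
  by rewrite lee_wpmul2l ?lee_fin ?(ltW K0)// leeD.
rewrite -EFinD -EFinM lee_fin le_eqVlt; apply/orP; left; apply/eqP; ring.
Qed.

(** Bernoulli's inequality without the summand 1; it yields an explicit [m] with |f x| <= b^m a. *)
Lemma expr_ge_mulrn (b : R) (m : nat) : 1 <= b -> m%:R * (b - 1) <= b ^+ m.
Proof.
move=> b1; suff : 1 + m%:R * (b - 1) <= b ^+ m by lra.
elim: m => [|m IH]; first by rewrite mul0r addr0 expr0.
have bm1 : 1 <= b ^+ m by exact: exprn_ege1.
by rewrite exprS -natr1; nra.
Qed.

(** The bound on finitely many annuli does not depend on their number, so the Fatou property carries
    it to the limit. *)
Lemma superlevel_part_norm_le (K b p w : R) (f : T -> R) : lmeasurable f ->
  1 <= K -> 1 < b -> 0 < w -> b `^ p = 2 * K * b ->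
  (forall g h, lmeasurable g -> lmeasurable h ->
    (N (g \+ h)%R <= K%:E * (N g + N h))%E) ->
  (forall a : R, 0 < a -> (N (ind f a) <= ((w / a) `^ p)%:E)%E) ->
  forall a : R, 0 < a ->
  (N (fun x => `|f x| * ind f a x)%R <= (2 * K * b * (a * (w / a) `^ p))%:E)%E.
Proof.
move=> mf K1 b1 w0 bp Ktri Nf a a0.
set g : T -> R := fun x => `|f x| * ind f a x.
pose u m : T -> R := fun x => `|f x| * (a < `|f x| <= b ^+ m * a)%R%:R.
have mg : lmeasurable g.
  apply: measurable_funM; last exact: lmeasurable_indic_superlevel.
  by apply: measurableT_comp mf; exact: normr_measurable.
have b0 : 0 < b by exact: lt_trans b1.
have [_ ucvg] : (forall m, (N (u m) <= N (u m.+1))%E) /\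
    (fun m => N (u m)) @ \oo --> N g.
  apply: (bq_fatou hN) => // [m|]; first exact: lmeasurable_annulus.
  apply: nearW => x; split => [m|].
    rewrite /u mulr_ge0//= ler_wpM2l// ler_nat.
    case: ltP => //= _; have [fb|//] := leP `|f x| (b ^+ m * a).
    rewrite (le_trans fb)// exprS -mulrA ler_peMl ?(ltW b1)//.
    by rewrite mulr_ge0 ?exprn_ge0 ?ltW.
  (* From [m0.+1] on, |f x| <= m (b-1) a <= b^m a, so the sequence is constant at [x]. *)
  pose m0 := Num.truncn (`|f x| / ((b - 1) * a)).
  apply: cvg_near_cst; exists m0.+1 => // m /= m0m.
  rewrite /u /g indic_superlevelE; case: ltP => //= _; congr (_ * _%:R).
  apply/eqP; rewrite eqb1.
  have ba : 0 < (b - 1) * a by rewrite mulr_gt0// subr_gt0.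
  have fm : `|f x| <= m%:R * ((b - 1) * a).
    rewrite -ler_pdivrMr//; apply/ltW/(lt_le_trans (truncnS_gt _)).
    by rewrite ler_nat.
  apply: le_trans fm _; rewrite mulrA ler_pM2r//; apply: expr_ge_mulrn.
  exact: ltW.
rewrite -(cvg_lim _ ucvg)//; apply: lime_le; first exact: cvgP ucvg.
by apply: nearW => m; apply: annulus_norm_le.
Qed.

(** After division by t^theta, the part above height [a] contributes [2 * K * b * w] and the bounded
    part [w]. *)
Lemma interp_norm_le (K b theta w : R) (f : T -> R) : lmeasurable f ->
  0 < theta < 1 ->
  1 <= K -> 1 < b -> 0 < w -> b `^ (1 - theta)^-1 = 2 * K * b ->
  (forall g h, lmeasurable g -> lmeasurable h ->
    (N (g \+ h)%R <= K%:E * (N g + N h))%E) ->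
  (forall a : R, 0 < a -> (N (ind f a) <= ((w / a) `^ (1 - theta)^-1)%:E)%E) ->
  (interp_norm N Linf theta f <= ((2 * K * b + 1) * w)%:E)%E.
Proof.
move=> mf /andP[th0 th1] K1 b1 w0 bp Ktri Nf.
have th1' : 1 - theta != 0 by rewrite subr_eq0 gt_eqF.
apply/ereal_supP => _ [t /= t0 <-].
have tp x : 0 < t `^ x by exact: powR_gt0.
rewrite powRN lee_pdivrMl// -EFinM.
(* This [a] balances the two terms: [a (w/a)^p = t a = w t^theta]. *)
pose a := w / t `^ (1 - theta).
have a0 : 0 < a by rewrite divr_gt0.
have tE : t `^ theta * t `^ (1 - theta) = t.
  by rewrite -powRD ?(gt_eqF t0) ?implybT// addrC subrK powRr1 // ltW.
have wap : (w / a) `^ (1 - theta)^-1 = t.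
  rewrite /a invf_div mulrCA divff ?gt_eqF// mulr1 -powRrM mulfV// powRr1//.
  exact: ltW.
have atE : a * t = w * t `^ theta.
  by rewrite /a -{2}tE; field; rewrite gt_eqF.
set f0 : T -> R := fun x => f x * ind f a x.
set f1 : T -> R := fun x => f x - f0 x.
have mf0 : lmeasurable f0.
  by apply: measurable_funM => //; exact: lmeasurable_indic_superlevel.
have mf1 : lmeasurable f1 by exact: measurable_funB.
have Nf0 : (N f0 <= (2 * K * b * (w * t `^ theta))%:E)%E.
  have := superlevel_part_norm_le _ _ _ _ _ mf K1 b1 w0 bp Ktri Nf _ a0.
  rewrite wap atE; apply: le_trans.
  apply: (bq_lattice hN) => //.
    apply: measurable_funM; last exact: lmeasurable_indic_superlevel.
    by apply: measurableT_comp mf; exact: normr_measurable.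
  by apply: nearW => x; rewrite /f0 !normrM normr_id.
have Lf1 : (Linf f1 <= a%:E)%E.
  apply/ess_supP; apply: nearW => x; rewrite lee_fin /f1 /f0 indic_superlevelE.
  by case: ltP => fx; rewrite ?mulr1 ?subrr ?normr0 ?(ltW a0)// mulr0 subr0.
apply: (@le_trans _ _ (N f0 + t%:E * Linf f1)%E).
  apply: ereal_inf_lbound; exists f0, f1; split => //.
  - by split => //; rewrite (le_lt_trans Nf0)// ltry.
  - by split => //; rewrite (le_lt_trans Lf1)// ltry.
  - by apply/funext => x; rewrite /f1/= addrC subrK.
apply: (@le_trans _ _ ((2 * K * b * (w * t `^ theta))%:E + t%:E * a%:E)%E).
  by rewrite leeD// lee_wpmul2l// lee_fin ltW.
by rewrite -EFinM -EFinD lee_fin [t * a]mulrC atE le_eqVlt; apply/orP; left; apply/eqP; ring.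
Qed.

Lemma interp_le_convexify_weak (theta : R) : 0 < theta < 1 ->
  exists2 C : R, 0 < C & forall f : T -> R, lmeasurable f ->
    (interp_norm N Linf theta f <= C%:E * convexify (weak N) (1 - theta)^-1 f)%E.
Proof.
move=> th; have /andP[th0 th1] := th.
have th1' : 0 < 1 - theta by rewrite subr_gt0.
have [K [K1 Ktri]] := bq_quasi_triangle hN.
have K2 : 1 < 2 * K by lra.
(* With p = 1/(1-theta), p - 1 = theta/(1-theta), so this [b] solves b^(p-1) = 2K; it exceeds 1
   because 2K does. *)
pose b := (2 * K) `^ ((1 - theta) / theta).
have b1 : 1 < b.
  rewrite /b /powR gt_eqF; last by lra.
  by rewrite expR_gt1 mulr_gt0 ?divr_gt0// ln_gt0.
have bp : b `^ (1 - theta)^-1 = 2 * K * b.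
  rewrite /b -powRrM -{2}[2 * K]powRr1; last by lra.
  rewrite -powRD; last by apply/implyP => _; rewrite gt_eqF//; lra.
  by congr (_ `^ _); field; rewrite !gt_eqF.
exists (2 * K * b + 1) => [|f mf].
  by rewrite addr_gt0// mulr_gt0//; [lra|exact: lt_trans b1].
apply: lee_pmul_gt; first by rewrite addr_gt0// mulr_gt0//; [lra|exact: lt_trans b1].
  exact: poweR_ge0.
move=> c Wc; have c0 : 0 < c.
  by rewrite -lte_fin; apply: le_lt_trans Wc; exact: poweR_ge0.
apply: interp_norm_le => //; apply/convexify_weak_leP => //; last exact: ltW.
by rewrite invr_gt0.
Qed.

End real_interpolation.

Theorem theorem4p1 (R : realType) (n : nat)
  (N : (LebRn R n -> R) -> \bar R) (theta : R) :
  ball_qBfs N ->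
  0 < theta < 1 ->
  (exists r : R, 0 < r /\ ball_Bfs (convexify N r^-1)) ->
  exists C : R, 0 < C /\
    forall f : LebRn R n -> R, lmeasurable f ->
      (in_interp N (@Linf_norm R n) theta f <->
         inX (convexify (weak N) (1 - theta)^-1) f) /\
      (interp_norm N (@Linf_norm R n) theta f
         <= C%:E * convexify (weak N) (1 - theta)^-1 f)%E /\
      (convexify (weak N) (1 - theta)^-1 f
         <= C%:E * interp_norm N (@Linf_norm R n) theta f)%E.
Proof.
move=> hN th _.
have [C C0 HC] := interp_le_convexify_weak _ _ _ hN _ th.
have mulC (c : R) (x : \bar R) : (x < +oo -> 0 <= x -> c%:E * x < +oo)%E.
  by case: x => // x _ _; rewrite -EFinM ltry.
(* The sum dominates the constants [C] and 2 of the two directions. *)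
exists (C + 2); split => [|f mf]; first by rewrite addr_gt0.
have upper := HC f mf.
have lower := convexify_weak_le_interp _ _ _ hN _ _ th mf.
have W0 : (0 <= convexify (weak N) (1 - theta)^-1 f)%E by exact: poweR_ge0.
have I0 := interp_norm_ge0 _ _ _ hN theta f.
split; [split => [[_ _ If]|[_ Wf]]|split].
- by split => //; apply: le_lt_trans lower _; exact: mulC.
- have If : (interp_norm N (@Linf_norm R n) theta f < +oo)%E.
    by apply: le_lt_trans upper _; exact: mulC.
  by split => //; exact: interp_norm_in_sum If.
- by apply: le_trans upper _; rewrite lee_wpmul2r// lee_fin lerDl.
- by apply: le_trans lower _; rewrite lee_wpmul2r// lee_fin lerDr ltW.
Qed.
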